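(* Suppose that the inputs $M_0$ and $D_0$ of the method PF-AR satisfy $M_0\le 2\bar L$ and $D_0\le D$. Then PF-AR, applied to $(\psi_s,\psi_n)$ with initial point $x_0\in\operatorname{dom}\psi_n$ and tolerance $\epsilon>0$, computes a pair $(\hat x,\hat v)$ such that $$\hat v\in\nabla\psi_s(\hat x)+\partial\psi_n(\hat x),\qquad \|\hat v\|\le\epsilon,$$ within at most $$\left[6+\log_2(2\bar L/M_0)\right]\left[1+\left\lceil\log_4\left(\frac{D}{D_0}\right)\right\rceil\right]+8\sqrt7\,C_1\sqrt{\frac{\bar L D}{\epsilon}}$$ gradient evaluations, where $C_1:=2\sqrt2+16\sqrt{2c_{\mathsf A}}$. Hence PF-AR achieves the gradient evaluation complexity bound $\mathcal O\left(\sqrt{\bar L D/\epsilon}\right)$ (as $\epsilon\to0$) for finding such a pair.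
   Context: Setting: $\mathbb E$ is a finite-dimensional inner product space; $\psi=\psi_s+\psi_n$ is to be minimized, where $\psi_s:\mathbb E\to\mathbb R$ is convex, differentiable, and $\bar L$-smooth ($\|\nabla\psi_s(x)-\nabla\psi_s(y)\|\le\bar L\|x-y\|$, $\bar L>0$), and $\psi_n$ is a closed proper convex function whose domain $\operatorname{dom}\psi_n$ is compact convex with diameter $D=\sup\{\|z-z'\|:z,z'\in\operatorname{dom}\psi_n\}$. Write $f=\psi_s$, $h=\psi_n$, $L_f=\bar L$. Backtracking$(f,h,\sigma,x,\bar x,M_0)$: for $j=0,1,\dots$ compute $x^{++}=\arg\min_u\langle\nabla f(x),u\rangle+h(u)+\frac{\sigma}{2}\|u-\bar x\|^2+M_j\|u-x\|^2$ and $x^{+}=\arg\min_u\langle\nabla f(x),u\rangle+h(u)+M_j\|u-x\|^2$. If $f(x^{++})-f(x)-\langle\nabla f(x),x^{++}-x\rangle\le\frac{M_j}{2}\|x^{++}-x\|^2$ and $\|\nabla f(x^+)-\nabla f(x)\|\le M_j\|x^+-x\|$, return $(x^{++},x^+,M_j)$; otherwise set $M_{j+1}=2M_j$. Inner solver $\mathsf A$ (assumed available): the call $x_s=\mathsf A(f,h,\sigma_s,\bar x_s,x_{s-1})$, started at $x_{s-1}$, approximately minimizes $\phi_s(u)=f(u)+h(u)+\frac{\sigma_s}{2}\|u-\bar x_s\|^2$, whose minimizer is $x_s^*$. After its $k$-th evaluation of $\nabla f$ it has a point $x_s^k\in\operatorname{dom}h$ and an estimate $L_s^k\le c_{\mathsf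 A}L_f$ ($c_{\mathsf A}$ a universal constant depending on $\mathsf A$) with $\phi_s(x_s^k)-\phi_s(x_s^* )\le\frac{L_s^k}{k^2}\|x_{s-1}-x_s^*\|^2$. It terminates whenever $k\ge8\sqrt{2L_s^k/\sigma_s}$ and then outputs $x_s=x_s^k$. AR-L$(f,h,x_0,\sigma_1,M_0)$, $x_0\in\operatorname{dom}h$, $\sigma_1,M_0>0$: for $s=1,2,\dots$: if $s=1$ set $\bar x_1=x_0$; if $s\ge2$ set $\sigma_s=4\sigma_{s-1}$, $\gamma_s=1-\sigma_{s-1}/\sigma_s$, $\bar x_s=(1-\gamma_s)\bar x_{s-1}+\gamma_sx_{s-1}$. Compute $x_s=\mathsf A(f,h,\sigma_s,\bar x_s,x_{s-1})$, then $(x_s^{++},x_s^+,M_s)=$ Backtracking$(f,h,\sigma_s,x_s,\bar x_s,M_{s-1})$ and $v_s=2M_s(x_s-x_s^+)-\nabla f(x_s)+\nabla f(x_s^+)$. Stop as soon as $M_s\le\sigma_s$ and output $(\hat x,\hat v,\hat M)=(x_s^+,v_s,M_s)$. PF-AR (inputs: pair $(f,h)$, $x_0\in\operatorname{dom}h$, $M_0>0$, $D_0>0$, tolerance $\epsilon>0$): for $t=1,2,\dots$ set $D_t=4D_{t-1}$, run AR-L$(f,h,x_{t-1},\epsilon/(7D_t),M_{t-1})$ and call its output $(x_t,v_t,M_t)$; stop as soon as $\|v_t\|\le\epsilon$ and output $(\hat x,\hat v)=(x_t,v_t)$. A gradient evaluation is an evaluation of $\nabla\psi_s$. *)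

(* Defs.v *)
From HB Require Import structures.
From mathcomp Require Import all_boot all_order all_algebra.
From mathcomp Require Import all_classical all_reals all_analysis.

Set Implicit Arguments.
Unset Strict Implicit.
Unset Printing Implicit Defensive.

Import Order.TTheory GRing.Theory Num.Theory.
Import numFieldNormedType.Exports.

Local Open Scope classical_set_scope.
Local Open Scope ring_scope.

(* A finite-dimensional real inner product space: finite-dimensionality is the
   [Vector] structure; the norm (hence the topology) is the one of [inner]. *)
HB.mixin Record isEuclidean (R : realType) E
    of NormedModule R E & Vector R E := {
  inner : {dot E for idfun} ;
  inner_norm : forall x : E, `|x| ^+ 2 = inner x x
}.

#[short(type="euclideanType")]
HB.structure Definition Euclidean (R : realType) :=
  { E of NormedModule R E & Vector R E & isEuclidean R E }.

Notation "'[ u , v ]" := (inner u v) : ring_scope.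

Section ConvexAnalysis.
Context {R : realType} {E : euclideanType R}.
Implicit Types (f : E -> R) (h : E -> \bar R) (x y z u g : E).

Definition is_gradient f (gradf : E -> E) : Prop :=
  forall x, differentiable f x /\ forall u, 'd f x u = '[gradf x, u].

Definition dom h : set E := [set x | (h x < +oo)%E].

Definition proper h : Prop := (forall x, h x != -oo%E) /\ dom h !=set0.

(* The library's [convex_function] is for real-valued functions only.  For
   functions avoiding -oo the convention 0 * +oo = 0 is harmless here. *)
Definition econvex h : Prop := forall x y (t : R), 0 <= t <= 1 ->
  (h (t *: x + (1 - t) *: y)%R <= t%:E * h x + (1 - t)%:E * h y)%E.

Definition closed_proper_convex h : Prop :=
  [/\ lower_semicontinuous h, proper h & econvex h].

Definition subdifferential h x : set E :=
  [set g | forall z, (h x + '[g, z - x]%:E <= h z)%E].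

Definition diameter (A : set E) : R :=
  sup [set `|p.1 - p.2| | p in A `*` A].

Definition argmin (F : E -> \bar R) x : Prop :=
  [set u | forall w, (F u <= F w)%E] = [set x].

End ConvexAnalysis.

(* The [k]-th iterate ([k >= 1], i.e. after [k] gradient evaluations) and the
   [k]-th curvature estimate of the inner solver, on the fixed pair (f, h),
   as functions of the prox parameter, the prox center and the starting
   point. *)
Record solver (R : realType) (E : euclideanType R) := Solver {
  iterate : R -> E -> E -> nat -> E ;
  estimate : R -> E -> E -> nat -> R
}.

(* The algorithms are big-step relations whose last argument counts gradient
   evaluations; a derivation exists only if the algorithm terminates. *)
Section Algorithms.
Context {R : realType} {E : euclideanType R}.
Variables (f : E -> R) (gradf : E -> E) (h : E -> \bar R) (A : solver E).

Definition phi (sigma : R) (xbar u : E) : \bar R :=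
  ((f u)%:E + h u + (sigma / 2 * `|u - xbar| ^+ 2)%:E)%E.

Definition inner_solver_spec (L cA : R) : Prop :=
  forall (sigma : R) (xbar x xstar : E) (k : nat),
    0 < sigma -> xbar \in dom h -> x \in dom h -> (0 < k)%N ->
    argmin (phi sigma xbar) xstar ->
    let xk := iterate A sigma xbar x k in
    let Lk := estimate A sigma xbar x k in
    [/\ xk \in dom h, Lk <= cA * L &
        (phi sigma xbar xk - phi sigma xbar xstar
           <= (Lk / k%:R ^+ 2 * `|x - xstar| ^+ 2)%:E)%E].

Definition inner_stop (sigma : R) (xbar x : E) (k : nat) : bool :=
  8 * Num.sqrt (2 * estimate A sigma xbar x k / sigma) <= k%:R.

Definition inner_call (sigma : R) (xbar x xs : E) (n : nat) : Prop :=
  [/\ (0 < n)%N, inner_stop sigma xbar x n,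
      forall k, (0 < k < n)%N -> ~~ inner_stop sigma xbar x k &
      xs = iterate A sigma xbar x n].

Definition obj_pp (sigma : R) (x xbar : E) (M : R) (u : E) : \bar R :=
  ('[gradf x, u]%:E + h u + (sigma / 2 * `|u - xbar| ^+ 2)%:E
     + (M * `|u - x| ^+ 2)%:E)%E.

Definition obj_p (x : E) (M : R) (u : E) : \bar R :=
  ('[gradf x, u]%:E + h u + (M * `|u - x| ^+ 2)%:E)%E.

Definition bt_test (x : E) (M : R) (xpp xp : E) : bool :=
  (f xpp - f x - '[gradf x, xpp - x] <= M / 2 * `|xpp - x| ^+ 2) &&
  (`|gradf xp - gradf x| <= M * `|xp - x|).

(* Each trial is charged one evaluation, at [xp]. *)
Inductive bt_trials (sigma : R) (x xbar : E) :
    R -> E -> E -> R -> nat -> Prop :=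
| bt_accept M xpp xp :
    argmin (obj_pp sigma x xbar M) xpp -> argmin (obj_p x M) xp ->
    bt_test x M xpp xp ->
    bt_trials sigma x xbar M xpp xp M 1
| bt_reject M xpp xp ypp yp M' n :
    argmin (obj_pp sigma x xbar M) xpp -> argmin (obj_p x M) xp ->
    ~~ bt_test x M xpp xp ->
    bt_trials sigma x xbar (2 * M) ypp yp M' n ->
    bt_trials sigma x xbar M ypp yp M' n.+1.

(* The extra evaluation is the one of the gradient at [x]. *)
Definition backtracking (sigma : R) (x xbar : E) (M0 : R)
    (xpp xp : E) (M : R) (n : nat) : Prop :=
  exists2 m, bt_trials sigma x xbar M0 xpp xp M m & n = m.+1.

(* The s-th iteration of AR-L, from (sigma_s, xbar_s, x_(s-1), M_(s-1)) to
   (x_s, x_s^+, v_s, M_s). *)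
Definition ar_step (sigma : R) (xbar x : E) (M : R)
    (xs xp v : E) (Ms : R) (n : nat) : Prop :=
  exists xpp n1 n2,
  [/\ inner_call sigma xbar x xs n1,
      backtracking sigma xs xbar M xpp xp Ms n2,
      v = (2 * Ms) *: (xs - xp) - gradf xs + gradf xp &
      n = (n1 + n2)%N].

Inductive ar_loop : R -> E -> E -> R -> E -> E -> R -> nat -> Prop :=
| ar_stop sigma xbar x M xs xp v Ms n :
    ar_step sigma xbar x M xs xp v Ms n -> Ms <= sigma ->
    ar_loop sigma xbar x M xp v Ms n
| ar_continue sigma xbar x M xs xp v Ms n xhat vhat Mhat n' :
    ar_step sigma xbar x M xs xp v Ms n -> sigma < Ms ->
    (let sigma' := 4 * sigma in
     let gamma := 1 - sigma / sigma' in
     ar_loop sigma' ((1 - gamma) *: xbar + gamma *: xs) xs Ms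
       xhat vhat Mhat n') ->
    ar_loop sigma xbar x M xhat vhat Mhat (n + n')%N.

Definition AR_L (x0 : E) (sigma1 M0 : R) : E -> E -> R -> nat -> Prop :=
  ar_loop sigma1 x0 x0 M0.

(* [pf_loop eps x M D] starts iteration t with x = x_(t-1), M = M_(t-1) and
   D = D_(t-1). *)
Inductive pf_loop (eps : R) : E -> R -> R -> E -> E -> nat -> Prop :=
| pf_stop x M D xt vt Mt n :
    AR_L x (eps / (7 * (4 * D))) M xt vt Mt n -> `|vt| <= eps ->
    pf_loop eps x M D xt vt n
| pf_continue x M D xt vt Mt n xhat vhat n' :
    AR_L x (eps / (7 * (4 * D))) M xt vt Mt n -> eps < `|vt| ->
    pf_loop eps xt Mt (4 * D) xhat vhat n' ->
    pf_loop eps x M D xhat vhat (n + n')%N.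

Definition PF_AR (x0 : E) (M0 D0 eps : R) : E -> E -> nat -> Prop :=
  pf_loop eps x0 M0 D0.

(* PF-AR terminates, and it does so with a pair as required after at most
   [B] gradient evaluations. *)
Definition PF_AR_solves_within (x0 : E) (M0 D0 eps B : R) : Prop :=
  (exists xhat vhat n, PF_AR x0 M0 D0 eps xhat vhat n) /\
  (forall xhat vhat n, PF_AR x0 M0 D0 eps xhat vhat n ->
    [/\ vhat \in [set gradf xhat + g | g in subdifferential h xhat],
        `|vhat| <= eps & n%:R <= B]).

End Algorithms.

Definition logb {R : realType} (b x : R) : R := ln x / ln b.

Definition C1 {R : realType} (cA : R) : R :=
  2 * Num.sqrt 2 + 16 * Num.sqrt (2 * cA).

(* Main.v *)
Require Import Defs.
From HB Require Import structures.
From mathcomp Require Import all_boot all_order all_algebra.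
From mathcomp Require Import all_classical all_reals all_analysis.
From mathcomp Require Import ring lra zify.

Import Order.TTheory GRing.Theory Num.Theory.
Import numFieldNormedType.Exports.

Local Open Scope classical_set_scope.
Local Open Scope ring_scope.

(** PF-AR is a guess-and-check loop around accumulative regularization, so the
    bound splits into three claims.

    The residual of one run of AR-L is at most [3 * sigma_1 * D].  Since
    [sigma_s xbar_s] accumulates [sigma_1 x_0] and the increments
    [(sigma_i - sigma_(i-1)) x_(i-1)], the objective [phi_s] equals [phi_(s-1)]
    plus a quadratic centered at [x_(s-1)], up to a constant.  Its minimizer
    [x_s^*] is therefore no farther from [x_(s-1)^*] and from [x_(s-1)] than
    [x_(s-1)] was from [x_(s-1)^*].  The stopping rule of the inner solver
    divides the distance to the minimizer by 8 while [sigma] is only multiplied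
    by 4, and the potential
      [sigma_s |x_s^* - xbar_s| + sigma_s |x_(s-1) - x_s^*|],
    initially at most [2 sigma_1 D], never increases ([regularization_step]).
    When the test [M_s <= sigma_s] stops the loop, the residual is at most 3/2
    of the potential ([residual_norm]); that step compares the two proximal
    points of the line search through the quadratic growth of their objectives
    around their minimizers ([quadratic_growth]).

    The number of gradient evaluations of a run of AR-L is dominated by a
    geometric sum.
    The inner solver costs about [8 sqrt (2 cA L / sigma_s)], which halves at
    each iteration; the line search costs [2 + log2 (M_s / M_(s-1))], which
    telescopes because [M_s] never exceeds [2 L]; and the number of iterations
    exceeds 2 only logarithmically in [L / sigma_1], which is absorbed in
    [2 sqrt (2 L / sigma_1)] ([AR_L_sound]).

    A run of AR-L with [D_t >= D] has a residual at most
    [3 D eps / (7 D_t) <= eps], so PF-AR stops at the latest when its guess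
    reaches [D]; the costs of the runs again form a geometric sum, dominated by
    the last guess, which is at most [4 D] ([pf_loop_sound]).

    Termination is a separate matter, as a derivation of the big-step relations
    has to be produced: the minimizers exist by compactness ([exists_argmin]),
    and each loop multiplies [M], [sigma] or the guess by a constant until it
    passes a threshold at which the loop must stop. *)

Set Implicit Arguments.
Unset Strict Implicit.

(** * Elementary estimates *)

Lemma leq_mul3_expn2 (k : nat) : (3 * k <= 2 * 2 ^ k)%N.
Proof.
elim: k => [|[|k] IH] //; rewrite expnS mulnS.
have : (2 <= 2 ^ k.+1)%N by rewrite expnS leq_pmulr // expn_gt0.
by move: IH; move: (2 ^ k.+1)%N => p; lia.
Qed.

Lemma exists_le_mul_expr (R : realType) (b : nat) (a c : R) :
  (1 < b)%N -> 0 < c -> exists j : nat, a <= c * b%:R ^+ j.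
Proof.
move=> b1 c0; exists (Num.truncn (a / c)).+1; rewrite mulrC -ler_pdivrMr //.
apply/ltW/(lt_le_trans (truncnS_gt _)).
by rewrite -natrX ler_nat ltnW // ltn_expl.
Qed.

(** * Inner products and the descent inequality *)

Section InnerProduct.
Context {R : realType} {E : euclideanType R}.
Implicit Types (x y z a g : E) (f : E -> R).

Lemma dotC x y : '[x, y] = '[y, x].
Proof. by rewrite (@hermC _ _ _ _ (@inner R E) x y) expr0 mul1r. Qed.

Lemma dotDr x y z : '[z, x + y] = '[z, x] + '[z, y].
Proof. exact: linearDr. Qed.

Lemma dotDl x y z : '[x + y, z] = '[x, z] + '[y, z].
Proof. exact: linearDl. Qed.

Lemma dotNr x z : '[z, - x] = - '[z, x].
Proof. exact: linearNr. Qed.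

Lemma dotNl x z : '[- x, z] = - '[x, z].
Proof. exact: linearNl. Qed.

Lemma dotZr (c : R) x z : '[z, c *: x] = c * '[z, x].
Proof. exact: linearZr. Qed.

Lemma dotZl (c : R) x z : '[c *: x, z] = c * '[x, z].
Proof. by rewrite dotC dotZr dotC. Qed.

Lemma sqr_normD x y : `|x + y| ^+ 2 = `|x| ^+ 2 + `|y| ^+ 2 + 2 * '[x, y].
Proof. by rewrite !inner_norm !(dotDr, dotDl) (dotC y x); ring. Qed.

(** Cauchy-Schwarz, read off the squared triangle inequality. *)
Lemma dot_le_norm x y : '[x, y] <= `|x| * `|y|.
Proof.
have : `|x + y| ^+ 2 <= (`|x| + `|y|) ^+ 2.
  by rewrite lerXn2r ?nnegrE ?addr_ge0 ?normr_ge0 ?ler_normD.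
rewrite sqr_normD sqrrD; lra.
Qed.

(** The exact defect of convexity of a squared distance.  It gives the strong
    convexity of the proximal terms, and it merges two quadratics with different
    centers into one. *)
Lemma sqr_norm_lerp (t : R) x y a :
  `|t *: x + (1 - t) *: y - a| ^+ 2 =
  t * `|x - a| ^+ 2 + (1 - t) * `|y - a| ^+ 2 - t * (1 - t) * `|x - y| ^+ 2.
Proof.
have -> : t *: x + (1 - t) *: y - a = t *: (x - a) + (1 - t) *: (y - a).
  rewrite !scalerBr addrACA -opprD -scalerDl.
  by rewrite [t + _]addrC subrK scale1r.
have -> : x - y = (x - a) - (y - a) by rewrite opprB addrA subrK.
move: (x - a) (y - a) => p q.
rewrite !inner_norm !(dotDr, dotDl, dotNr, dotNl, dotZr, dotZl) (dotC q p).
by ring.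
Qed.

(** Along the segment, the difference [p] of the two sides has derivative
    [<grad f (x + t d) - grad f x, d> - L t |d|^2], nonpositive by
    Cauchy-Schwarz; the mean value theorem concludes. *)
Lemma descent_inequality f (gradf : E -> E) (L : R) : is_gradient f gradf ->
  (forall x y, `|gradf x - gradf y| <= L * `|x - y|) ->
  forall x y, f y <= f x + '[gradf x, y - x] + L / 2 * `|y - x| ^+ 2.
Proof.
move=> gradfE lipL x y; set d := y - x.
pose p (t : R) :=
  f (x + t *: d) - t * '[gradf x, d] - L / 2 * t ^+ 2 * `|d| ^+ 2.
have dp (t : R) : is_derive t 1 p
    ('[gradf (x + t *: d), d] - '[gradf x, d] - L * t * `|d| ^+ 2).
  have [df dfE] := gradfE (x + t *: d).
  have path : is_diff t (fun s : R => x + s *: d) ( *:%R^~ d).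
    have := is_diffD (is_diff_cst x t) (is_diff_scalel t d).
    by rewrite add0r.
  have dfp : is_derive t 1 (fun s : R => f (x + s *: d))
      '[gradf (x + t *: d), d].
    have dfx := differentiableP df.
    have [dc dcE] := is_diff_comp path dfx.
    apply: DeriveDef; first exact: diff_derivable.
    by rewrite deriveE // dcE /= scale1r dfE.
  have -> : p = (fun s => f (x + s *: d)) - '[gradf x, d] \*: id
                - (L / 2 * `|d| ^+ 2) \*: (id ^+ 2).
    apply/funext => s; rewrite /p; congr (_ - _ - _); first exact: mulrC.
    exact: mulrAC.
  apply: is_derive_eq.
  rewrite /GRing.scale /= expr1; move: '[_, d] '[_, d] `|d| => a b c; lra.
have := @MVT_segment R p _ 0 1 ler01 (fun t _ => dp t).
case.
  by apply: derivable_within_continuous => t _; apply: ex_derive.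
move=> c; rewrite in_itv /= => /andP[c0 c1].
have xdE : x + d = y by rewrite /d addrC subrK.
rewrite subr0 mulr1 /p scale0r scale1r addr0 xdE => pE.
have : '[gradf (x + c *: d) - gradf x, d] <= L * c * `|d| ^+ 2.
  apply: (le_trans (dot_le_norm _ _)).
  rewrite expr2 mulrA ler_wpM2r //; apply: (le_trans (lipL _ _)).
  by rewrite addrC addKr normrZ ger0_norm // mulrA.
rewrite dotDl dotNl; move: pE; lra.
Qed.
End InnerProduct.

(** * Minimizing a closed convex function plus a strongly convex one *)

Section ComposedObjective.
Context {R : realType} {E : euclideanType R}.
Implicit Types (r s : E -> R) (h : E -> \bar R) (x y z u w : E).

(** The modulus 0 is plain convexity, so that smooth parts and proximal terms
    are added by the single rule [strongly_convexD]. *)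
Definition strongly_convex (mu : R) r := forall x y (t : R), 0 <= t <= 1 ->
  r (t *: x + (1 - t) *: y) <=
  t * r x + (1 - t) * r y - mu / 2 * (t * (1 - t) * `|x - y| ^+ 2).

Lemma strongly_convexD mu nu r s : strongly_convex mu r ->
  strongly_convex nu s -> strongly_convex (mu + nu) (fun u => r u + s u).
Proof.
move=> cr cs x y t t01; have := lerD (cr x y t t01) (cs x y t t01).
by move=> /le_trans; apply; rewrite le_eqVlt; apply/orP; left; apply/eqP; ring.
Qed.

Lemma strongly_convex_sqr_dist (c : R) a :
  strongly_convex (2 * c) (fun u => c * `|u - a| ^+ 2).
Proof. by move=> x y t _; rewrite sqr_norm_lerp; lra. Qed.

Lemma strongly_convex_dot g : strongly_convex 0 (fun u => '[g, u]).
Proof. by move=> x y t _; rewrite dotDr !dotZr; lra. Qed.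

Lemma strongly_convex0 r :
  convex_function (E := E) setT r -> strongly_convex 0 r.
Proof.
move=> cr x y t /andP[t0 t1].
have := cr (Itv01 t0 t1) x y; rewrite !in_setT => /(_ isT isT).
by rewrite !mul0r subr0.
Qed.

(** All the objectives of the method have this form, with the extended-real
    part [h] fixed; estimates then take place in [R], on [dom h]. *)
Definition composed h r u : \bar R := (h u + (r u)%:E)%E.

Lemma proper_fineK h x : Defs.proper h -> x \in dom h -> (fine (h x))%:E = h x.
Proof.
move=> [hNy _]; rewrite inE /dom /= => hxy.
by apply: fineK; rewrite fin_numElt ltNye hNy hxy.
Qed.

Lemma minimizer_in_dom h r x : Defs.proper h ->
  (forall w, composed h r x <= composed h r w)%E -> x \in dom h.
Proof.
move=> ph xmin; have [_ [w wdom]] := ph.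
rewrite inE /dom /= ltNge leye_eq; apply/negP => /eqP hx.
have := xmin w; rewrite /composed hx addye // leye_eq => /eqP.
by move: (wdom); rewrite -(proper_fineK ph (mem_set wdom)).
Qed.

Lemma econvex_dom h x y (t : R) : Defs.proper h -> econvex h -> 0 <= t <= 1 ->
  x \in dom h -> y \in dom h ->
  t *: x + (1 - t) *: y \in dom h /\
  fine (h (t *: x + (1 - t) *: y)) <= t * fine (h x) + (1 - t) * fine (h y).
Proof.
move=> ph ch t01 xdom ydom.
have := ch x y t t01.
rewrite -(proper_fineK ph xdom) -(proper_fineK ph ydom) -!EFinM -EFinD => hle.
have zdom : t *: x + (1 - t) *: y \in dom h.
  by rewrite inE /dom /=; apply: (le_lt_trans hle); rewrite ltry.
by split; [exact: zdom | rewrite -lee_fin (proper_fineK ph zdom)].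
Qed.

(** Compare [x] with [t w + (1 - t) x]: strong convexity gives a gap of
    [(1 - t) mu / 2 |w - x|^2], and [t] is arbitrarily small.  This is how
    optimality of a minimizer is used everywhere below. *)
Lemma quadratic_growth h r (mu : R) x : Defs.proper h -> econvex h ->
  strongly_convex mu r -> (forall w, composed h r x <= composed h r w)%E ->
  forall w, w \in dom h ->
  fine (h x) + r x + mu / 2 * `|w - x| ^+ 2 <= fine (h w) + r w.
Proof.
move=> ph ch cr xmin w wdom; have xdom := minimizer_in_dom ph xmin.
set a := fine (h x) + r x; set b := fine (h w) + r w.
set N := mu / 2 * `|w - x| ^+ 2.
have chord (t : R) : 0 < t <= 1 -> a + (1 - t) * N <= b.
  move=> /andP[t0 t1]; have t01 : 0 <= t <= 1 by rewrite ltW.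
  have [zdom hz] := econvex_dom ph ch t01 wdom xdom.
  have := xmin (t *: w + (1 - t) *: x); rewrite /composed.
  rewrite -(proper_fineK ph xdom) -(proper_fineK ph zdom) -!EFinD lee_fin.
  move=> az; have rz := cr w x t t01.
  by rewrite -(ler_pM2l t0) /a /b /N; lra.
rewrite leNgt; apply/negP => ab.
have [Ngt0|] := ltP 0 N; last first.
  by move=> N_le0; have := chord 1; rewrite ltr01 lexx => /(_ isT); lra.
have ba : a <= b by have := chord 1; rewrite ltr01 lexx => /(_ isT); lra.
(* The value of [t] for which the chord exceeds [b] by half of the assumed
   violation [a + N - b]. *)
pose t := (a + N - b) / (2 * N).
have t0 : 0 < t by apply: divr_gt0; lra.
have tN : 2 * (t * N) = a + N - b by rewrite /t; field; rewrite gt_eqF.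
have t1 : t <= 1 by rewrite /t ler_pdivrMr; lra.
have /chord : 0 < t <= 1 by rewrite t0 t1.
lra.
Qed.

Lemma composed_lower_semicontinuous h r : lower_semicontinuous h ->
  continuous r -> lower_semicontinuous (composed h r).
Proof.
move=> lsch cr x a; rewrite /composed -lteBlDr // -EFinB => ahx.
have [c ac chx] : exists2 c : R, a - r x < c & (c%:E < h x)%E.
  case: (h x) ahx => [b||] //.
  - rewrite lte_fin => ab; exists ((a - r x + b) / 2); rewrite ?lte_fin; lra.
  - by move=> _; exists (a - r x + 1); rewrite ?ltry // ltrDl.
have [V xV hV] := lsch x c chx.
have rV : \forall y \near x, a - c < r y.
  by apply: (cvgr_gt (r x) (cr x)); lra.
exists (V `&` [set y | a - c < r y]); first exact: filterI.
move=> y [/hV cy /= ry]; rewrite -lteBlDr // -EFinB; apply: le_lt_trans cy.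
by rewrite lee_fin; lra.
Qed.

Lemma exists_seq_min (F : E -> \bar R) (D : seq E) x0 : x0 \in D ->
  exists2 x, x \in D & forall y, y \in D -> (F x <= F y)%E.
Proof.
elim: D x0 => // a D IH x0 _; case: D IH => [_|b D IH].
  by exists a => [|y]; rewrite inE // => /eqP ->.
have [x xD xmin] := IH b (mem_head _ _).
have [Fax|Fxa] := leP (F a) (F x).
  exists a => [|y]; first exact: mem_head.
  by rewrite inE => /orP[/eqP -> //|/xmin]; apply: le_trans.
exists x => [|y]; first by rewrite inE xD orbT.
by rewrite inE => /orP[/eqP ->|/xmin //]; apply: ltW.
Qed.

(** If no point were a minimizer, the sets [F w < F x] with [w] in the domain
    would be an open cover of [dom h]; in a finite subcover, the best of the
    centers [w] is itself beaten by another center. *)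
Lemma exists_argmin h r (mu : R) : closed_proper_convex h -> compact (dom h) ->
  continuous r -> 0 < mu -> strongly_convex mu r ->
  exists x, argmin (composed h r) x.
Proof.
move=> [lsch ph ch] domc cr mu0 scr.
pose F := composed h r.
have [x xmin] : exists x, forall w, (F x <= F w)%E.
  apply: contrapT => /forallNP nomin.
  have openF w : w \in dom h -> open [set x | (F w < F x)%E].
    move=> wdom; rewrite /F {1}/composed -(proper_fineK ph wdom) -EFinD.
    have /lower_semicontinuousP := composed_lower_semicontinuous lsch cr.
    exact.
  have better x : exists2 w, w \in dom h & (F w < F x)%E.
    have /existsNP[w /negP] := nomin x; rewrite -ltNge => Fwx.
    exists w => //; rewrite inE /dom /= ltNge leye_eq; apply/negP => /eqP hw.
    by move: Fwx; rewrite /F {1}/composed hw addye // ltNge leey.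
  move: domc; rewrite compact_cover => domc.
  have [||D Dsub Dcov] := domc E (dom h) (fun w => [set x | (F w < F x)%E]).
  - by move=> w wdom; apply: openF; rewrite inE.
  - move=> x _; have [w wdom Fwx] := better x.
    by exists w => //; exact: set_mem.
  have [w0 w0dom] : dom h !=set0 by case: ph.
  have [d0 d0D _] := Dcov w0 w0dom.
  have [v vD vmin] := exists_seq_min F d0D.
  have [d dD Fd] := Dcov v (set_mem (Dsub _ vD)).
  by have := vmin d dD; rewrite leNgt Fd.
exists x; apply/seteqP; split => [y /= ymin|y /= -> //].
have xdom := minimizer_in_dom ph xmin.
have := quadratic_growth ph ch scr ymin xdom.
have := quadratic_growth ph ch scr xmin (minimizer_in_dom ph ymin).
rewrite [`|x - y|]distrC => h1 h2.
have : mu / 2 * `|y - x| ^+ 2 <= 0 by lra.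
rewrite pmulr_rle0 ?divr_gt0 // => /(conj (sqr_ge0 `|y - x|)) /andP.
by rewrite -eq_le eq_sym sqrf_eq0 normr_eq0 subr_eq0 => /eqP.
Qed.

End ComposedObjective.

(** * The three objectives of an iteration *)

Section Iteration.
Context {R : realType} {E : euclideanType R}.
Context (f : E -> R) (gradf : E -> E) (h : E -> \bar R) (A : solver E).
Context (L cA : R).
Context (f_convex : convex_function (E := E) setT f).
Context (f_grad : is_gradient f gradf).
Context (L_gt0 : 0 < L).
Context (gradf_lip : forall x y, `|gradf x - gradf y| <= L * `|x - y|).
Context (h_cpc : closed_proper_convex h).
Context (h_compact : compact (dom h)).
Context (cA_gt0 : 0 < cA).
Context (A_spec : inner_solver_spec f h A L cA).
Implicit Types (x y u w v xbar : E) (sigma M : R).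

Let h_proper : Defs.proper h. Proof. by case: h_cpc. Qed.
Let h_convex : econvex h. Proof. by case: h_cpc. Qed.

Lemma argmin_growth r (mu : R) x : strongly_convex mu r ->
  argmin (composed h r) x ->
  x \in dom h /\ forall w, w \in dom h ->
  fine (h x) + r x + mu / 2 * `|w - x| ^+ 2 <= fine (h w) + r w.
Proof.
move=> cr xmin.
have {}xmin : forall w, (composed h r x <= composed h r w)%E.
  by have : [set x] x by []; rewrite -xmin.
by split; [exact: minimizer_in_dom xmin | exact: quadratic_growth].
Qed.

(** The real-valued parts of [phi], [obj_pp] and [obj_p], once [h] is set
    aside. *)
Definition phi_smooth sigma xbar u := f u + sigma / 2 * `|u - xbar| ^+ 2.
Definition pp_smooth sigma x xbar M u :=
  '[gradf x, u] + sigma / 2 * `|u - xbar| ^+ 2 + M * `|u - x| ^+ 2.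
Definition p_smooth x M u := '[gradf x, u] + M * `|u - x| ^+ 2.

Lemma phiE sigma xbar : phi f h sigma xbar = composed h (phi_smooth sigma xbar).
Proof.
by apply/funext => u; rewrite /phi /composed EFinD addeA [(h u + _)%E]addeC.
Qed.

Lemma obj_ppE sigma x xbar M :
  obj_pp gradf h sigma x xbar M = composed h (pp_smooth sigma x xbar M).
Proof.
apply/funext => u.
by rewrite /obj_pp /composed !EFinD !addeA [(h u + _)%E]addeC.
Qed.

Lemma obj_pE x M : obj_p gradf h x M = composed h (p_smooth x M).
Proof.
by apply/funext => u; rewrite /obj_p /composed EFinD addeA [(h u + _)%E]addeC.
Qed.

Lemma phi_smooth_sc sigma xbar : strongly_convex sigma (phi_smooth sigma xbar).
Proof.
have := strongly_convexD (strongly_convex0 f_convex)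
  (strongly_convex_sqr_dist (sigma / 2) xbar).
by rewrite add0r mulrC divfK.
Qed.

Lemma pp_smooth_sc sigma x xbar M :
  strongly_convex (sigma + 2 * M) (pp_smooth sigma x xbar M).
Proof.
have := strongly_convexD (strongly_convexD (strongly_convex_dot (gradf x))
  (strongly_convex_sqr_dist (sigma / 2) xbar)) (strongly_convex_sqr_dist M x).
by rewrite add0r [2 * (sigma / 2)]mulrC divfK.
Qed.

Lemma p_smooth_sc x M : strongly_convex (2 * M) (p_smooth x M).
Proof.
have := strongly_convexD (strongly_convex_dot (gradf x))
  (strongly_convex_sqr_dist M x).
by rewrite add0r.
Qed.

Let cont_sqr_dist (c : R) a : continuous (fun u : E => c * `|u - a| ^+ 2).
Proof.
move=> u; apply: cvgM; first exact: cvg_cst.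
have cn : (fun w : E => `|w - a|) @ u --> `|u - a|.
  by apply: cvg_norm; apply: cvgB => //; exact: cvg_cst.
by rewrite expr2; under eq_fun do rewrite expr2; apply: cvgM.
Qed.

(* Polarization reduces the continuity of the inner product to that of the
   norm. *)
Let cont_dot g : continuous (fun u : E => '[g, u]).
Proof.
move=> u; have -> : (fun w => '[g, w]) =
    (fun w => 4^-1 * (`|w - (- g)| ^+ 2) - 4^-1 * `|w - g| ^+ 2).
  apply/funext => w; rewrite opprK !inner_norm.
  by rewrite !(dotDr, dotDl, dotNr, dotNl) (dotC w g); lra.
by apply: cvgB; apply: cont_sqr_dist.
Qed.

Lemma exists_phi_argmin sigma xbar : 0 < sigma ->
  exists xstar, argmin (phi f h sigma xbar) xstar.
Proof.
move=> sigma0; rewrite phiE; apply: exists_argmin (phi_smooth_sc _ _) => //.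
move=> u; apply: cvgD; last exact: cont_sqr_dist.
by apply: differentiable_continuous; case: (f_grad u).
Qed.

Lemma exists_pp_argmin sigma x xbar M : 0 < sigma -> 0 < M ->
  exists xpp, argmin (obj_pp gradf h sigma x xbar M) xpp.
Proof.
move=> sigma0 M0; rewrite obj_ppE.
apply: exists_argmin (pp_smooth_sc _ _ _ _) => //.
  move=> u; apply: cvgD; last exact: cont_sqr_dist.
  by apply: cvgD; [exact: cont_dot | exact: cont_sqr_dist].
lra.
Qed.

Lemma exists_p_argmin x M : 0 < M -> exists xp, argmin (obj_p gradf h x M) xp.
Proof.
move=> M0; rewrite obj_pE; apply: exists_argmin (p_smooth_sc _ _) => //.
  by move=> u; apply: cvgD; [exact: cont_dot | exact: cont_sqr_dist].
lra.
Qed.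

(** For a quadratic, the growth inequality at the minimizer is exactly the
    subgradient inequality: the terms in [|z - xp|^2] cancel. *)
Lemma residual_subgradient x M xp : argmin (obj_p gradf h x M) xp ->
  xp \in dom h /\
  (2 * M) *: (x - xp) - gradf x + gradf xp \in
    [set gradf xp + g | g in subdifferential h xp].
Proof.
rewrite obj_pE => /(argmin_growth (p_smooth_sc x M))[xpdom growth].
split=> //; rewrite inE /=.
exists ((2 * M) *: (x - xp) - gradf x); last by rewrite addrC.
move=> z; have [zdom|] := boolP (z \in dom h); last first.
  rewrite notin_setE /dom /= => /negP; rewrite -leNgt leye_eq => /eqP ->.
  exact: leey.
rewrite -(proper_fineK h_proper xpdom) -(proper_fineK h_proper zdom).
rewrite -EFinD lee_fin; have := growth z zdom; rewrite /p_smooth.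
have -> : '[gradf x, z] = '[gradf x, z - xp] + '[gradf x, xp].
  by rewrite -dotDr subrK.
have -> : z - x = (z - xp) - (x - xp) by rewrite opprB addrA subrK.
have -> : xp - x = - (x - xp) by rewrite opprB.
rewrite normrN; move: (z - xp) (x - xp) => d e.
rewrite !inner_norm !(dotDr, dotDl, dotNr, dotNl, dotZr, dotZl) (dotC e d).
lra.
Qed.

(** * Estimates at an accepted trial *)

(** The line search can only reject when [M < L]; this makes it terminate and
    never lets a doubling take [M] above [2 L]. *)
Lemma bt_accepts x M xpp xp : L <= M -> bt_test f gradf x M xpp xp.
Proof.
move=> LM; apply/andP; split.
  have := descent_inequality f_grad gradf_lip x xpp.
  have : L / 2 * `|xpp - x| ^+ 2 <= M / 2 * `|xpp - x| ^+ 2.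
    by rewrite ler_wpM2r ?exprn_ge0 // ler_pM2r ?invr_gt0.
  lra.
by apply: (le_trans (gradf_lip _ _)); rewrite ler_wpM2r.
Qed.

(** Both objectives share the term [M |u - x|^2], and only one of them has the
    term [sigma / 2 |u - xbar|^2]: adding their growth inequalities leaves
    [2 M |xpp - xp|^2 <= sigma <xp - xpp, xpp - xbar>]. *)
Lemma prox_shift sigma x xbar M xpp xp : 0 < sigma ->
  argmin (obj_pp gradf h sigma x xbar M) xpp ->
  argmin (obj_p gradf h x M) xp ->
  2 * M * `|xpp - xp| <= sigma * `|xpp - xbar|.
Proof.
move=> sigma0.
rewrite obj_ppE => /(argmin_growth (pp_smooth_sc _ _ _ _))[ppdom ppgrowth].
rewrite obj_pE => /(argmin_growth (p_smooth_sc _ _))[pdom pgrowth].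
have := ppgrowth _ pdom; have := pgrowth _ ppdom; rewrite /pp_smooth /p_smooth.
have -> : xp - xbar = (xp - xpp) + (xpp - xbar) by rewrite addrA subrK.
rewrite [`|xpp - xp|]distrC (sqr_normD (xp - xpp)).
have := dot_le_norm (xp - xpp) (xpp - xbar).
have := normr_ge0 (xp - xpp).
set N := `|xp - xpp|; set B := `|xpp - xbar|.
rewrite le_eqVlt => /predU1P[<-|N0].
  move=> _ _ _; rewrite mulr0.
  by apply: mulr_ge0; [exact: ltW | exact: normr_ge0].
move=> cs g1 g2; rewrite -(ler_pM2r N0).
have : sigma * '[xp - xpp, xpp - xbar] <= sigma * (N * B) by rewrite ler_pM2l.
rewrite expr2 in g1 g2 *.
lra.
Qed.

(** Moving to [xpp] decreases [phi] by at least
    [(sigma + 3 M) / 2 |xpp - x|^2], which cannot exceed the gap of [x]. *)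
Lemma gradient_step_bound sigma x xbar M xpp xstar (r : R) :
  0 < sigma -> 0 < M -> 0 <= r -> x \in dom h ->
  argmin (obj_pp gradf h sigma x xbar M) xpp ->
  f xpp - f x - '[gradf x, xpp - x] <= M / 2 * `|xpp - x| ^+ 2 ->
  argmin (phi f h sigma xbar) xstar ->
  fine (h x) + phi_smooth sigma xbar x <=
    fine (h xstar) + phi_smooth sigma xbar xstar + sigma / 128 * r ^+ 2 ->
  `|xpp - x| <= r / 8.
Proof.
move=> sigma0 M0 r0 xdom.
rewrite obj_ppE => /(argmin_growth (pp_smooth_sc _ _ _ _))[ppdom ppgrowth] test.
rewrite phiE => /(argmin_growth (phi_smooth_sc _ _))[sdom sgrowth] gap.
have := ppgrowth _ xdom; have := sgrowth _ ppdom; move: gap test.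
rewrite /pp_smooth /phi_smooth dotDr dotNr subrr normr0 [`|x - xpp|]distrC.
rewrite expr0n /= mulr0 => gap test g1 g2.
have : 0 <= sigma / 2 * `|xpp - xstar| ^+ 2.
  by rewrite mulr_ge0 ?sqr_ge0 //; lra.
have : 0 <= M * `|xpp - x| ^+ 2 by rewrite mulr_ge0 ?sqr_ge0 // ltW.
move=> hM hs.
have : sigma * `|xpp - x| ^+ 2 <= sigma * (r / 8) ^+ 2.
  by rewrite [(r / 8) ^+ 2]expr_div_n; lra.
by rewrite ler_pM2l // ler_pXn2r // nnegrE ?divr_ge0.
Qed.

(** The residual is at most [3 M |xp - x|], and [xp] is reached through [xpp];
    once [M <= sigma], every length that appears is weighted by [sigma] and
    controlled by the potential. *)
Lemma residual_norm sigma x xbar M xpp xp xstar (r : R) :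
  0 < sigma -> 0 < M -> M <= sigma -> 0 <= r -> x \in dom h ->
  argmin (obj_pp gradf h sigma x xbar M) xpp ->
  argmin (obj_p gradf h x M) xp ->
  bt_test f gradf x M xpp xp ->
  argmin (phi f h sigma xbar) xstar ->
  fine (h x) + phi_smooth sigma xbar x <=
    fine (h xstar) + phi_smooth sigma xbar xstar + sigma / 128 * r ^+ 2 ->
  `|x - xstar| <= r / 8 ->
  `|(2 * M) *: (x - xp) - gradf x + gradf xp| <=
    3 / 2 * (sigma * `|xstar - xbar| + sigma * r).
Proof.
move=> sigma0 M0 Msigma r0 xdom ppmin pmin /andP[test1 test2] smin gap.
move=> near_star.
have step := gradient_step_bound sigma0 M0 r0 xdom ppmin test1 smin gap.
have shift := prox_shift sigma0 ppmin pmin.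
have vle : `|(2 * M) *: (x - xp) - gradf x + gradf xp| <= 3 * (M * `|xp - x|).
  rewrite -addrA [- _ + _]addrC; apply: (le_trans (ler_normD _ _)).
  by rewrite normrZ distrC gtr0_norm ?mulr_gt0 //; lra.
have tri1 : M * `|xp - x| <= M * `|xpp - xp| + M * `|xpp - x|.
  by rewrite -mulrDr ler_pM2l // [`|xpp - xp|]distrC ler_distD.
have tri2 : sigma * `|xpp - xbar| <=
    sigma * `|xpp - x| + sigma * `|x - xstar| + sigma * `|xstar - xbar|.
  rewrite -!mulrDr ler_pM2l //.
  apply: (le_trans (ler_distD xstar _ _)); rewrite lerD2r.
  exact: ler_distD.
have b1 : M * `|xpp - x| <= sigma * `|xpp - x| by rewrite ler_wpM2r.
have b2 : sigma * `|xpp - x| <= sigma * (r / 8) by rewrite ler_pM2l.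
have b3 : sigma * `|x - xstar| <= sigma * (r / 8) by rewrite ler_pM2l.
have b4 : 0 <= sigma * r by rewrite mulr_ge0 // ltW.
lra.
Qed.

(** * The cost of the line search and of the inner solver *)

Let lg (M : R) := logb 2 M.

Lemma lg_double M : 0 < M -> lg (2 * M) = 1 + lg M.
Proof.
move=> M0; rewrite /lg /logb lnM ?posrE // mulrDl divff //.
by rewrite gt_eqF // ln_gt0 // ltr1n.
Qed.

(** The number of trials is an exact function of the doubling of [M], so that
    the costs of successive line searches telescope. *)
Lemma bt_trials_sound sigma x xbar M xpp xp M' n :
  bt_trials f gradf h sigma x xbar M xpp xp M' n -> 0 < M -> M <= 2 * L ->
  [/\ M <= M' <= 2 * L, n%:R = 1 + lg M' - lg M,
      argmin (obj_pp gradf h sigma x xbar M') xpp,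
      argmin (obj_p gradf h x M') xp & bt_test f gradf x M' xpp xp].
Proof.
elim=> {M xpp xp M' n}.
  by move=> M xpp xp ppmin pmin test M0 ML; split; rewrite ?lexx //; lra.
move=> M xpp xp ypp yp M' n _ _ ntest _ IH M0 ML.
have ltML : M < L.
  by rewrite ltNge; apply: contra ntest; exact: bt_accepts.
have [||/andP[MM' M'L] nE ? ? ?] := IH; [lra|lra|].
split=> //; first by apply/andP; split=> //; lra.
by rewrite -natr1 nE lg_double //; lra.
Qed.

Lemma bt_trials_exists sigma x xbar (j : nat) M : 0 < sigma -> 0 < M ->
  L <= M * 2 ^+ j ->
  exists xpp xp M' n, bt_trials f gradf h sigma x xbar M xpp xp M' n.
Proof.
move=> sigma0; elim: j M => [|j IH] M M0 LM.
  have [xpp ppmin] := exists_pp_argmin x xbar sigma0 M0.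
  have [xp pmin] := exists_p_argmin x M0.
  exists xpp, xp, M, 1; apply: bt_accept => //; apply: bt_accepts.
  by rewrite expr0 mulr1 in LM.
have [xpp ppmin] := exists_pp_argmin x xbar sigma0 M0.
have [xp pmin] := exists_p_argmin x M0.
have [test|ntest] := boolP (bt_test f gradf x M xpp xp).
  by exists xpp, xp, M, 1; apply: bt_accept.
have [||ypp [yp [M' [n trials]]]] := IH (2 * M); first lra.
  by rewrite [2 * M]mulrC -mulrA -exprS.
by exists ypp, yp, M', n.+1; apply: bt_reject ntest trials.
Qed.

(** The stopping rule [8 sqrt (2 Lk / sigma) <= k] means
    [Lk / k^2 <= sigma / 128]. *)
Lemma inner_iterate_gap sigma xbar x xstar k : 0 < sigma ->
  xbar \in dom h -> x \in dom h -> argmin (phi f h sigma xbar) xstar ->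
  (0 < k)%N -> inner_stop A sigma xbar x k ->
  let xk := iterate A sigma xbar x k in
  xk \in dom h /\
  fine (h xk) + phi_smooth sigma xbar xk <=
    fine (h xstar) + phi_smooth sigma xbar xstar
    + sigma / 128 * `|x - xstar| ^+ 2.
Proof.
move=> sigma0 xbardom xdom smin k0 stop.
have [xkdom _ gap] := A_spec sigma0 xbardom xdom k0 smin.
split=> //; move: smin gap; rewrite phiE => smin.
have [sdom _] := argmin_growth (phi_smooth_sc sigma xbar) smin.
rewrite /composed -(proper_fineK h_proper xkdom) -(proper_fineK h_proper sdom).
rewrite -!EFinD lee_fin /=.
set Lk := estimate A sigma xbar x k; set N := `|x - xstar| ^+ 2.
have k0R : (0 : R) < k%:R by rewrite ltr0n.
have : 2 * Lk / sigma <= (k%:R / 8) ^+ 2.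
  rewrite -ler_sqrt ?exprn_gt0 ?divr_gt0 // sqrtr_sqr ger0_norm ?divr_ge0 //.
  by rewrite ler_pdivlMr // mulrC.
rewrite ler_pdivrMr // expr_div_n => hLk.
have : Lk / k%:R ^+ 2 * N <= sigma / 128 * N.
  rewrite ler_wpM2r ?sqr_ge0 // ler_pdivrMr ?exprn_gt0 //; lra.
lra.
Qed.

(** With [r] the distance from the starting point to the minimizer, this is
    the contraction by 8 achieved by one call of the inner solver. *)
Lemma near_argmin sigma xbar x xstar (r : R) : 0 < sigma -> 0 <= r ->
  x \in dom h -> argmin (phi f h sigma xbar) xstar ->
  fine (h x) + phi_smooth sigma xbar x <=
    fine (h xstar) + phi_smooth sigma xbar xstar + sigma / 128 * r ^+ 2 ->
  `|x - xstar| <= r / 8.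
Proof.
move=> sigma0 r0 xdom; rewrite phiE.
move=> /(argmin_growth (phi_smooth_sc sigma xbar))[_ /(_ x xdom) growth] gap.
have : sigma * `|x - xstar| ^+ 2 <= sigma * (r / 8) ^+ 2.
  by rewrite [(r / 8) ^+ 2]expr_div_n; lra.
by rewrite ler_pM2l // ler_pXn2r // nnegrE ?divr_ge0.
Qed.

(** One eighth of the number of steps after which the stopping rule must hold,
    given that the estimates never exceed [cA * L]. *)
Definition inner_budget sigma := Num.sqrt (2 * cA * L / sigma).

Lemma inner_budget_ge0 sigma : 0 <= inner_budget sigma.
Proof. exact: sqrtr_ge0. Qed.

Lemma inner_budgetM4 sigma : 0 < sigma ->
  inner_budget (4 * sigma) = inner_budget sigma / 2.
Proof.
move=> sigma0; rewrite /inner_budget.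
have -> : 2 * cA * L / (4 * sigma) = 2 * cA * L / sigma * (2^-1) ^+ 2.
  by field; rewrite gt_eqF.
rewrite sqrtrM ?sqrtr_sqr ?ger0_norm //.
by rewrite divr_ge0 ?mulr_ge0 // ltW.
Qed.

Lemma inner_stop_budget sigma xbar x k : 0 < sigma ->
  xbar \in dom h -> x \in dom h -> (0 < k)%N ->
  8 * inner_budget sigma <= k%:R -> inner_stop A sigma xbar x k.
Proof.
move=> sigma0 xbardom xdom k0.
have [xstar smin] := exists_phi_argmin xbar sigma0.
have [_ Lk _] := A_spec sigma0 xbardom xdom k0 smin.
apply: le_trans; rewrite ler_pM2l //; apply: ler_wsqrtr.
by rewrite ler_pM2r ?invr_gt0 // -mulrA ler_pM2l.
Qed.

(** The step before the last did not satisfy the stopping rule. *)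
Lemma inner_call_count sigma xbar x xs n : 0 < sigma ->
  xbar \in dom h -> x \in dom h -> inner_call A sigma xbar x xs n ->
  n%:R <= 1 + 8 * inner_budget sigma.
Proof.
move=> sigma0 xbardom xdom [n0 _ before _].
have [n_le1|n_gt1] := leqP n 1.
  have := inner_budget_ge0 sigma; have : n%:R <= 1 :> R by rewrite lern1.
  lra.
rewrite leNgt; apply/negP => over.
have := before n.-1; rewrite -ltnS prednK // n_gt1 leqnn => /(_ isT) /negP.
apply.
apply: inner_stop_budget => //; first by rewrite -ltnS prednK.
by move: over; rewrite -{1}(prednK n0) -natr1; lra.
Qed.

Lemma inner_call_exists sigma xbar x : 0 < sigma ->
  xbar \in dom h -> x \in dom h -> exists xs n, inner_call A sigma xbar x xs n.
Proof.
move=> sigma0 xbardom xdom.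
pose stops k := (0 < k)%N && inner_stop A sigma xbar x k.
have ex : exists k, stops k.
  pose k := (Num.truncn (8 * inner_budget sigma)).+1.
  exists k; apply/andP; split=> //; apply: inner_stop_budget => //.
  exact/ltW/truncnS_gt.
case: (ex_minnP ex) => n /andP[n0 stop] nmin.
exists (iterate A sigma xbar x n), n; split=> // k /andP[k0 kn].
apply/negP => kstop.
by have := nmin k; rewrite /stops k0 kstop leqNgt kn => /(_ isT).
Qed.

(** * Accumulative regularization *)

(** The heart of the analysis.  The new objective is the old one plus
    [3 / 2 sigma |u - xs|^2] and a constant; adding the growth inequalities of
    both minimizers bounds [|ystar - xstar|] and [|ystar - xs|] by
    [e = |xs - xstar|].  The first term of the potential then grows by at most
    [4 sigma e] and the second one becomes at most [4 sigma e]; both are paid by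
    [8 sigma e <= sigma r], the old second term. *)
Lemma regularization_step sigma xbar xs xstar ystar (r : R) : 0 < sigma ->
  argmin (phi f h sigma xbar) xstar -> `|xs - xstar| <= r / 8 ->
  let gamma := 1 - sigma / (4 * sigma) in
  let ybar := (1 - gamma) *: xbar + gamma *: xs in
  argmin (phi f h (4 * sigma) ybar) ystar ->
  4 * sigma * `|ystar - ybar| + 4 * sigma * `|xs - ystar| <=
    sigma * `|xstar - xbar| + sigma * r.
Proof.
move=> sigma0; rewrite phiE => smin near_star gamma ybar.
have gammaE : gamma = 1 - 4^-1 by rewrite /gamma; field; rewrite gt_eqF.
have [sdom sgrowth] := argmin_growth (phi_smooth_sc _ _) smin.
rewrite phiE => /(argmin_growth (phi_smooth_sc _ _))[ydom ygrowth].
have phi_next u : phi_smooth (4 * sigma) ybar u = phi_smooth sigma xbar u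
    + 3 / 2 * sigma * `|u - xs| ^+ 2 - 3 / 8 * sigma * `|xbar - xs| ^+ 2.
  have := sqr_norm_lerp 4^-1 xbar xs u.
  rewrite [`|xbar - u|]distrC [`|xs - u|]distrC [`|_ - u|]distrC.
  rewrite /phi_smooth /ybar gammaE subKr => ->; lra.
set e := `|xs - xstar| in near_star *.
have e0 : 0 <= e by exact: normr_ge0.
have /sgrowth g1 := ydom; have /ygrowth g2 := sdom.
move: g2; rewrite !phi_next [`|xstar - xs|]distrC [`|xstar - ystar|]distrC -/e.
move=> g2.
have main : 5 * `|ystar - xstar| ^+ 2 + 3 * `|ystar - xs| ^+ 2 <= 3 * e ^+ 2.
  rewrite -(ler_pM2l sigma0); lra.
have p1 := sqr_ge0 `|ystar - xstar|; have p2 := sqr_ge0 `|ystar - xs|.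
have d1 : `|ystar - xstar| <= e.
  by rewrite -(ler_pXn2r (ltn0Sn 1)) // ?nnegrE //; lra.
have d2 : `|ystar - xs| <= e.
  by rewrite -(ler_pXn2r (ltn0Sn 1)) // ?nnegrE //; lra.
have d3 : 4 * `|ystar - ybar| <= `|ystar - xbar| + 3 * `|ystar - xs|.
  have -> : 4 * `|ystar - ybar| = `|(ystar - xbar) + 3 *: (ystar - xs)|.
    rewrite -[4 in LHS](ger0_norm) // -normrZ; congr `|_|.
    rewrite /ybar gammaE subKr !scalerBr !scalerDr !scalerA.
    have -> : 4 * 4^-1 = 1 :> R by field.
    have -> : 4 * (1 - 4^-1) = 3 :> R by field.
    by rewrite scale1r opprD addrACA -[4]/(1 + 3) scalerDl scale1r.
  by apply: (le_trans (ler_normD _ _)); rewrite normrZ ger0_norm.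
have d4 : `|ystar - xbar| <= `|ystar - xstar| + `|xstar - xbar|.
  exact: ler_distD.
rewrite [`|xs - ystar|]distrC -!mulrDr -mulrA mulrCA ler_pM2l //.
lra.
Qed.

(** * Termination and complexity of AR-L *)

Definition stationary_pair xhat vhat :=
  vhat \in [set gradf xhat + g | g in subdifferential h xhat].

Lemma ar_step_sound sigma xbar x M xs xp v Ms n xstar :
  ar_step f gradf h A sigma xbar x M xs xp v Ms n ->
  0 < sigma -> xbar \in dom h -> x \in dom h -> 0 < M -> M <= 2 * L ->
  argmin (phi f h sigma xbar) xstar ->
  [/\ xs \in dom h /\ `|xs - xstar| <= `|x - xstar| / 8,
      xp \in dom h /\ stationary_pair xp v,
      M <= Ms <= 2 * L,
      n%:R <= 3 + (lg Ms - lg M) + 8 * inner_budget sigma &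
      Ms <= sigma ->
      `|v| <= 3 / 2 * (sigma * `|xstar - xbar| + sigma * `|x - xstar|)].
Proof.
move=> [xpp [n1 [n2 [call [m trials ->] -> ->]]]].
move=> sigma0 xbardom xdom M0 ML smin.
have [n1_gt0 stop _ xsE] := call.
have := inner_iterate_gap sigma0 xbardom xdom smin n1_gt0 stop.
rewrite -xsE => -[xsdom gap].
have near_star := near_argmin sigma0 (normr_ge0 _) xsdom smin gap.
have [/andP[MMs MsL] mE ppmin pmin test] := bt_trials_sound trials M0 ML.
have Ms0 : 0 < Ms by exact: lt_le_trans MMs.
split=> //.
- exact: residual_subgradient.
- by rewrite MMs.
- have := inner_call_count sigma0 xbardom xdom call.
  by rewrite natrD -[m.+1%:R]natr1 mE; lra.
- move=> Msigma.
  exact: (residual_norm sigma0 Ms0 Msigma (normr_ge0 _) xsdom ppmin pmin test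
            smin gap near_star).
Qed.

Lemma ar_step_exists sigma xbar x M : 0 < sigma -> xbar \in dom h ->
  x \in dom h -> 0 < M ->
  exists xs xp v Ms n, ar_step f gradf h A sigma xbar x M xs xp v Ms n.
Proof.
move=> sigma0 xbardom xdom M0.
have [xs [n1 call]] := inner_call_exists sigma0 xbardom xdom.
have [j LM] := exists_le_mul_expr (b := 2) L isT M0.
have [xpp [xp [Ms [m trials]]]] := bt_trials_exists xs xbar sigma0 M0 LM.
exists xs, xp, ((2 * Ms) *: (xs - xp) - gradf xs + gradf xp), Ms, (n1 + m.+1)%N.
by exists xpp, n1, m.+1; split=> //; exists m.
Qed.

Lemma next_center_dom sigma xbar xs : 0 < sigma -> xbar \in dom h ->
  xs \in dom h ->
  (1 - (1 - sigma / (4 * sigma))) *: xbar + (1 - sigma / (4 * sigma)) *: xs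
    \in dom h.
Proof.
move=> sigma0 xbardom xsdom; rewrite addrC.
have gamma01 : 0 <= 1 - sigma / (4 * sigma) <= 1.
  have -> : 1 - sigma / (4 * sigma) = 3 / 4 by field; rewrite gt_eqF.
  by apply/andP; split; lra.
by have [] := econvex_dom h_proper h_convex gamma01 xsdom xbardom.
Qed.

(** Here [k] is the number of iterations beyond the first, and [B] bounds the
    potential.  An iteration is followed by another one only if
    [sigma < M <= 2 L], whence the geometric condition on [k]. *)
Lemma ar_loop_sound sigma xbar x M xhat vhat Mhat n :
  ar_loop f gradf h A sigma xbar x M xhat vhat Mhat n -> forall B : R,
  0 < sigma -> xbar \in dom h -> x \in dom h -> 0 < M -> M <= 2 * L ->
  (forall xstar, argmin (phi f h sigma xbar) xstar ->
    sigma * `|xstar - xbar| + sigma * `|x - xstar| <= B) ->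
  [/\ xhat \in dom h /\ stationary_pair xhat vhat,
      `|vhat| <= 3 / 2 * B,
      M <= Mhat <= 2 * L &
      exists2 k : nat, (k = 0)%N \/ sigma * 4 ^+ k.-1 < 2 * L &
      n%:R <= 3 * k.+1%:R + (lg Mhat - lg M) + 16 * inner_budget sigma].
Proof.
elim=> {sigma xbar x M xhat vhat Mhat n}.
  move=> sigma xbar x M xs xp v Ms n step Msigma B.
  move=> sigma0 xbardom xdom M0 ML potB.
  have [xstar smin] := exists_phi_argmin xbar sigma0.
  have [_ xpP MMs nle /(_ Msigma) vle] :=
    ar_step_sound step sigma0 xbardom xdom M0 ML smin.
  split=> //; first by have := potB _ smin; lra.
  exists 0%N; first by left.
  by have := inner_budget_ge0 sigma; lra.
move=> sigma xbar x M xs xp v Ms n xhat vhat Mhat n' step ltMs _ IH B.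
move=> sigma0 xbardom xdom M0 ML potB.
have [xstar smin] := exists_phi_argmin xbar sigma0.
have [[xsdom near_star] _ /andP[MMs MsL] nle _] :=
  ar_step_sound step sigma0 xbardom xdom M0 ML smin.
have [|||||ystar ymin|xhatP vle /andP[MsMhat MhatL] [k kP n'le]] := IH B.
- lra.
- exact: next_center_dom.
- exact: xsdom.
- exact: lt_le_trans MMs.
- exact: MsL.
- apply: le_trans (potB _ smin).
  exact: (regularization_step sigma0 smin near_star ymin).
split=> //; first by rewrite MhatL andbT (le_trans MMs).
exists k.+1.
  right; case: kP => [->|]; first by rewrite mulr1; lra.
  case: k {n'le} => [|k] /=; first by rewrite !expr0 !mulr1; lra.
  by rewrite exprS; lra.
move: n'le; rewrite inner_budgetM4 // natrD -[k.+2%:R]natr1; lra.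
Qed.

(** After [j] iterations [sigma] has reached [2 L], which bounds every [M]. *)
Lemma ar_loop_exists (j : nat) sigma xbar x M : 0 < sigma -> xbar \in dom h ->
  x \in dom h -> 0 < M -> M <= 2 * L -> 2 * L <= sigma * 4 ^+ j ->
  exists xhat vhat Mhat n, ar_loop f gradf h A sigma xbar x M xhat vhat Mhat n.
Proof.
elim: j sigma xbar x M => [|j IH] sigma xbar x M;
  move=> sigma0 xbardom xdom M0 ML sigmaL;
  have [xs [xp [v [Ms [n step]]]]] := ar_step_exists sigma0 xbardom xdom M0;
  have [xstar smin] := exists_phi_argmin xbar sigma0;
  have [[xsdom _] _ /andP[MMs MsL] _ _] :=
    ar_step_sound step sigma0 xbardom xdom M0 ML smin.
  exists xp, v, Ms, n; apply: ar_stop step _.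
  by rewrite expr0 in sigmaL; lra.
have [Msigma|ltMs] := leP Ms sigma.
  by exists xp, v, Ms, n; apply: ar_stop step _.
have [||||||xhat [vhat [Mhat [n' loop]]]] := IH (4 * sigma)
  ((1 - (1 - sigma / (4 * sigma))) *: xbar + (1 - sigma / (4 * sigma)) *: xs)
  xs Ms.
- lra.
- exact: next_center_dom.
- exact: xsdom.
- exact: lt_le_trans MMs.
- exact: MsL.
- by move: sigmaL; rewrite exprS; lra.
by exists xhat, vhat, Mhat, (n + n')%N; apply: ar_continue step ltMs loop.
Qed.

Lemma diameter_ge x y : x \in dom h -> y \in dom h ->
  `|x - y| <= diameter (dom h).
Proof.
rewrite !inE => xdom ydom; apply: ub_le_sup; last by exists (x, y).
have [N [_ Nbound]] := compact_bounded h_compact.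
exists (2 * (`|N| + 1)) => _ [[u w] /= [udom wdom] <-].
have bound z : dom h z -> `|z| <= `|N| + 1.
  move=> zdom; apply: (Nbound (`|N| + 1)) => //.
  by rewrite ltr_pwDr // ler_norm.
apply: (le_trans (ler_normB _ _)).
have := bound u udom; have := bound w wdom; lra.
Qed.

(** The potential starts at [2 sigma |x - xstar|] because the first center is
    the starting point.  For [k >= 1], the evaluations beyond the first 6 that
    do not come from a budget number [3 (k - 1)], and they are paid by
    [2 * 2 ^ (k - 1) <= 2 sqrt (2 L / sigma)]. *)
Lemma AR_L_sound x sigma M xhat vhat Mhat n :
  AR_L f gradf h A x sigma M xhat vhat Mhat n ->
  0 < sigma -> x \in dom h -> 0 < M -> M <= 2 * L ->
  [/\ xhat \in dom h /\ stationary_pair xhat vhat,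
      `|vhat| <= 3 * sigma * diameter (dom h),
      M <= Mhat <= 2 * L &
      n%:R <= 6 + (lg Mhat - lg M) + C1 cA * Num.sqrt (L / sigma)].
Proof.
move=> loop sigma0 xdom M0 ML.
have [xstar|xhatP vle MhatP [k kP nle]] :=
  ar_loop_sound (B := 2 * (sigma * diameter (dom h)))
    loop sigma0 xdom xdom M0 ML.
  rewrite phiE => /(argmin_growth (phi_smooth_sc _ _))[sdom _].
  have : sigma * `|x - xstar| <= sigma * diameter (dom h).
    by rewrite ler_pM2l // diameter_ge.
  by rewrite [`|xstar - x|]distrC; lra.
split=> //; first lra.
apply: (le_trans nle); rewrite /C1.
have budgetE : inner_budget sigma = Num.sqrt (2 * cA) * Num.sqrt (L / sigma).
  by rewrite /inner_budget -mulrA sqrtrM // mulr_ge0 // ltW.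
have kle : 3 * k.+1%:R <= 6 + 2 * Num.sqrt 2 * Num.sqrt (L / sigma).
  have root0 : 0 <= Num.sqrt 2 * Num.sqrt (L / sigma) by rewrite mulr_ge0.
  case: k kP {nle} => [|k] kP; first by rewrite mulr1; lra.
  have {kP} /= kL : sigma * 4 ^+ k < 2 * L by case: kP.
  have : 2 ^+ k <= Num.sqrt 2 * Num.sqrt (L / sigma).
    rewrite -sqrtrM // -[2 ^+ k]ger0_norm ?exprn_ge0 // -sqrtr_sqr.
    rewrite ler_wsqrtr // -exprM mulnC exprM mulrA ler_pdivlMr //.
    rewrite [_ * sigma]mulrC; have -> : 2 ^+ 2 = 4 :> R by rewrite expr2 -natrM.
    exact: ltW.
  have : 3 * k%:R <= 2 * 2 ^+ k :> R.
    rewrite -!natrX -!natrM ler_nat; exact: leq_mul3_expn2.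
  rewrite -[k.+2%:R]natr1 -[k.+1%:R]natr1; lra.
rewrite budgetE; lra.
Qed.

(** * The parameter-free loop *)

Let D := diameter (dom h).

(** A run of AR-L whose guess is [4 d] costs [pf_rate eps * (2 * sqrt d)], up to
    the additive and telescoping terms. *)
Definition pf_rate (eps : R) := C1 cA * Num.sqrt (7 * L / eps).

Lemma pf_call_sound (eps : R) x M (d : R) xhat vhat Mhat n : 0 < eps -> 0 < d ->
  AR_L f gradf h A x (eps / (7 * (4 * d))) M xhat vhat Mhat n ->
  x \in dom h -> 0 < M -> M <= 2 * L ->
  [/\ xhat \in dom h /\ stationary_pair xhat vhat,
      D <= 4 * d -> `|vhat| <= eps,
      M <= Mhat <= 2 * L &
      n%:R <= 6 + (lg Mhat - lg M) + pf_rate eps * (2 * Num.sqrt d)].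
Proof.
move=> eps0 d0 call xdom M0 ML.
have d28 : 0 < 7 * (4 * d) by lra.
have sigma0 : 0 < eps / (7 * (4 * d)) by rewrite divr_gt0.
have [xhatP vle MhatP nle] := AR_L_sound call sigma0 xdom M0 ML.
split=> //.
  move=> Dd; apply: (le_trans vle); rewrite -/D.
  have -> : 3 * (eps / (7 * (4 * d))) * D = eps * (3 * D / (7 * (4 * d))).
    by field; rewrite gt_eqF.
  by rewrite -[leRHS]mulr1 ler_pM2l // ler_pdivrMr //; lra.
have budgetE : Num.sqrt (L / (eps / (7 * (4 * d)))) =
    Num.sqrt (7 * L / eps) * (2 * Num.sqrt d).
  have -> : L / (eps / (7 * (4 * d))) = 7 * L / eps * (2 ^+ 2 * d).
    by field; rewrite !gt_eqF.
  rewrite sqrtrM ?divr_ge0 ?mulr_ge0 ?ltW //.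
  by rewrite [Num.sqrt (2 ^+ 2 * d)]sqrtrM ?exprn_ge0 // sqrtr_sqr ger0_norm.
by rewrite -mulrA -budgetE.
Qed.

Lemma logb4_step (d : R) : 0 < D -> 0 < d ->
  logb 4 (D / (4 * d)) = logb 4 (D / d) - 1.
Proof.
move=> D0 d0.
have -> : D / d = 4 * (D / (4 * d)) by field; rewrite gt_eqF.
rewrite /logb [ln (4 * _)]lnM ?posrE ?divr_gt0 ?mulr_gt0 //.
rewrite [(_ + ln _) / _]mulrDl divff; first lra.
by rewrite gt_eqF // ln_gt0 // ltr1n.
Qed.

Lemma pf_rate_ge0 (eps : R) : 0 <= pf_rate eps.
Proof. by rewrite mulr_ge0 ?sqrtr_ge0 // addr_ge0 ?mulr_ge0 ?sqrtr_ge0. Qed.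

(** In units of [pf_rate eps], the remaining runs cost [2 sqrt d], [4 sqrt d]
    and so on.  The last term of the bound sums this geometric series: it loses
    [2 sqrt d] when [d] becomes [4 d], and it still covers the last run since
    [d <= D]. *)
Lemma pf_loop_sound (eps : R) x M (d : R) xhat vhat n : 0 < eps ->
  pf_loop f gradf h A eps x M d xhat vhat n ->
  x \in dom h -> 0 < M -> M <= 2 * L -> 0 < d -> d <= D ->
  [/\ stationary_pair xhat vhat, `|vhat| <= eps &
      n%:R <= 6 * (1 + logb 4 (D / d)) + (lg (2 * L) - lg M)
              + pf_rate eps * (4 * Num.sqrt D - 2 * Num.sqrt d)].
Proof.
move=> eps0; elim=> {x M d xhat vhat n}.
  move=> x M d xt vt Mt n call vle xdom M0 ML d0 dD.
  have [[_ xtP] _ /andP[MMt MtL] nle] := pf_call_sound eps0 d0 call xdom M0 ML.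
  split=> //; apply: (le_trans nle).
  have lgMt : lg Mt <= lg (2 * L).
    rewrite ler_pM2r ?invr_gt0 ?ln_gt0 ?ltr1n // ler_ln // posrE; lra.
  have log0 : 0 <= logb 4 (D / d).
    rewrite divr_ge0 ?ln_ge0 ?ler1n //.
    by rewrite ler_pdivlMr // mul1r.
  have : pf_rate eps * (2 * Num.sqrt d) <=
      pf_rate eps * (4 * Num.sqrt D - 2 * Num.sqrt d).
    rewrite ler_wpM2l ?pf_rate_ge0 //.
    by have := ler_wsqrtr dD; lra.
  lra.
move=> x M d xt vt Mt n xhat vhat n' call vgt _ IH xdom M0 ML d0 dD.
have [[xtdom _] small /andP[MMt MtL] nle] :=
  pf_call_sound eps0 d0 call xdom M0 ML.
have d4D : 4 * d <= D.
  by apply/ltW; rewrite ltNge; apply/negP => /small; rewrite leNgt vgt.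
have [|||//|xhatP vle n'le] := IH xtdom; [lra | lra | lra | ].
split=> //; move: n'le; rewrite natrD logb4_step //; last exact: lt_le_trans dD.
have -> : Num.sqrt (4 * d) = 2 * Num.sqrt d.
  rewrite -[4]/(2 * 2)%:R natrM -expr2 sqrtrM ?exprn_ge0 //.
  by rewrite sqrtr_sqr ger0_norm.
lra.
Qed.

Lemma pf_loop_exists (j : nat) (eps : R) x M (d : R) : 0 < eps ->
  x \in dom h -> 0 < M -> M <= 2 * L -> 0 < d -> D <= d * 4 ^+ j ->
  exists xhat vhat n, pf_loop f gradf h A eps x M d xhat vhat n.
Proof.
move=> eps0; elim: j x M d => [|j IH] x M d xdom M0 ML d0 Dd;
  have sigma0 : 0 < eps / (7 * (4 * d)) by [rewrite divr_gt0 ?mulr_gt0];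
  have [i Li] := exists_le_mul_expr (b := 4) (2 * L) isT sigma0;
  have [xt [vt [Mt [n call]]]] := ar_loop_exists sigma0 xdom xdom M0 ML Li;
  have [[xtdom _] small /andP[MMt MtL] _] :=
    pf_call_sound eps0 d0 call xdom M0 ML.
  exists xt, vt, n; apply: pf_stop call _; apply: small.
  by rewrite expr0 in Dd; lra.
have [vle|vgt] := leP `|vt| eps.
  by exists xt, vt, n; apply: pf_stop call _.
have [|||||xhat [vhat [n' loop]]] := IH xt Mt (4 * d) => //.
- exact: lt_le_trans MMt.
- lra.
- by move: Dd; rewrite exprS; lra.
by exists xhat, vhat, (n + n')%N; apply: pf_continue call vgt loop.
Qed.

Lemma PF_AR_solves x0 (M0 D0 eps : R) : x0 \in dom h ->
  0 < M0 -> M0 <= 2 * L -> 0 < D0 -> D0 <= D -> 0 < eps ->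
  PF_AR_solves_within f gradf h A x0 M0 D0 eps
    (6 * (1 + logb 4 (D / D0)) + logb 2 (2 * L / M0)
     + 4 * Num.sqrt 7 * C1 cA * Num.sqrt (L * D / eps)).
Proof.
move=> xdom M0_gt0 M0L D0_gt0 D0D eps0.
have D_gt0 : 0 < D by exact: lt_le_trans D0D.
split.
  have [j Dj] := exists_le_mul_expr (b := 4) D isT D0_gt0.
  exact: (pf_loop_exists eps0 xdom M0_gt0 M0L D0_gt0 Dj).
move=> xhat vhat n /(pf_loop_sound eps0)[] // xhatP vle nle.
split=> //; apply: (le_trans nle).
have -> : logb 2 (2 * L / M0) = lg (2 * L) - lg M0.
  by rewrite /lg /logb ln_div ?posrE ?mulr_gt0 // mulrBl.
rewrite lerD2l.
have -> : L * D / eps = L / eps * D by rewrite mulrAC.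
have Leps0 : 0 <= L / eps by rewrite divr_ge0 ?ltW.
rewrite /pf_rate -[7 * L / eps]mulrA.
rewrite [Num.sqrt (7 * _)]sqrtrM // [Num.sqrt (L / eps * _)]sqrtrM //.
have -> : 4 * Num.sqrt 7 * C1 cA * (Num.sqrt (L / eps) * Num.sqrt D) =
    C1 cA * (Num.sqrt 7 * Num.sqrt (L / eps)) * (4 * Num.sqrt D) by ring.
apply: ler_wpM2l; last by have := sqrtr_ge0 D0; lra.
by rewrite /C1 !(mulr_ge0, addr_ge0, sqrtr_ge0).
Qed.

End Iteration.

(** * The complexity bounds *)

Lemma PF_AR_solves_within_le (R : realType) (E : euclideanType R)
    (f : E -> R) (gradf : E -> E) (h : E -> \bar R) (A : solver E)
    (x0 : E) (M0 D0 eps B B' : R) : B <= B' ->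
  PF_AR_solves_within f gradf h A x0 M0 D0 eps B ->
  PF_AR_solves_within f gradf h A x0 M0 D0 eps B'.
Proof.
move=> BB' [run sound]; split=> // xhat vhat n /sound[? ? nB].
by split=> //; exact: le_trans BB'.
Qed.

(* C is quantified before the problem: the constant hidden in the O depends on
   c_A only, while the range of eps may depend on the problem and the inputs *)
Theorem theorem2p6 (R : realType) (cA : R) (cA_gt0 : 0 < cA) :
  exists C : R,
  forall (E : euclideanType R)
    (psi_s : E -> R) (grad_psi_s : E -> E) (psi_n : E -> \bar R) (Lbar : R)
    (A : solver E) (x0 : E) (M0 D0 : R),
  let D := diameter (dom psi_n) in
  convex_function setT psi_s ->
  is_gradient psi_s grad_psi_s ->
  0 < Lbar ->
  (forall x y, `|grad_psi_s x - grad_psi_s y| <= Lbar * `|x - y|) ->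
  closed_proper_convex psi_n ->
  compact (dom psi_n) ->
  inner_solver_spec psi_s psi_n A Lbar cA ->
  x0 \in dom psi_n ->
  0 < M0 -> M0 <= 2 * Lbar ->
  0 < D0 -> D0 <= D ->
  (forall eps : R, 0 < eps ->
    PF_AR_solves_within psi_s grad_psi_s psi_n A x0 M0 D0 eps
      ((6 + logb 2 (2 * Lbar / M0))
         * (1 + (Num.ceil (logb 4 (D / D0)))%:~R)
       + 8 * Num.sqrt 7 * C1 cA * Num.sqrt (Lbar * D / eps)))
  /\
  (\forall eps \near 0^'+,
    PF_AR_solves_within psi_s grad_psi_s psi_n A x0 M0 D0 eps
      (C * Num.sqrt (Lbar * D / eps))).
Proof.
exists (1 + 4 * Num.sqrt 7 * C1 cA).
move=> E psi_s grad_psi_s psi_n Lbar A x0 M0 D0 D.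
move=> cvx grad L0 lip cpc comp spec x0dom M0_gt0 M0L D0_gt0 D0D.
have solves := PF_AR_solves cvx grad L0 lip cpc comp cA_gt0 spec x0dom M0_gt0
  M0L D0_gt0 D0D.
have D_gt0 : 0 < D by exact: lt_le_trans D0D.
have log2_ge0 : 0 <= logb 2 (2 * Lbar / M0).
  by rewrite divr_ge0 ?ln_ge0 ?ler1n // ler_pdivlMr // mul1r.
have log4_ge0 : 0 <= logb 4 (D / D0).
  by rewrite divr_ge0 ?ln_ge0 ?ler1n // ler_pdivlMr // mul1r.
have C1_ge0 : 0 <= C1 cA by rewrite /C1 !(mulr_ge0, addr_ge0, sqrtr_ge0).
split=> [eps eps0|].
  apply: PF_AR_solves_within_le (solves eps eps0); apply: lerD.
    set l2 := logb 2 _ in log2_ge0 *; set l4 := logb 4 _ in log4_ge0 *.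
    have : l4 <= (Num.ceil l4)%:~R by exact: ceil_ge.
    move: (_%:~R) => c l4c.
    have : 0 <= l2 * c by rewrite mulr_ge0 //; lra.
    lra.
  have : 0 <= Num.sqrt 7 * C1 cA * Num.sqrt (Lbar * D / eps).
    by rewrite !(mulr_ge0, sqrtr_ge0).
  lra.
(* The terms that do not depend on [eps] are below [sqrt (Lbar D / eps)] as
   soon as [eps <= Lbar D / K^2]. *)
pose K := 6 * (1 + logb 4 (D / D0)) + logb 2 (2 * Lbar / M0).
have K_gt0 : 0 < K by rewrite /K; lra.
have bound_gt0 : 0 < Lbar * D / K ^+ 2 by rewrite divr_gt0 ?mulr_gt0 ?exprn_gt0.
near=> eps.
have eps0 : 0 < eps by near: eps; exact: nbhs_right_gt.
have epsK : eps <= Lbar * D / K ^+ 2 by near: eps; exact: nbhs_right_le.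
have K_le : K <= Num.sqrt (Lbar * D / eps).
  rewrite -(ger0_norm (ltW K_gt0)) -sqrtr_sqr ler_wsqrtr //.
  by rewrite ler_pdivlMr // mulrC -ler_pdivlMr // exprn_gt0.
apply: PF_AR_solves_within_le (solves eps eps0).
by move: K_le; rewrite /K -/D; lra.
Unshelve. all: by end_near.
Qed.
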